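(* Let the design $\boldsymbol X_1,\dots,\boldsymbol X_n\in[0,1]^d$ be either deterministic or random. If for some positive $\alpha<(\log3-\log2)/\log3$ the inequality $$\frac{d^*(\log d-\log d^* )}{n}\ge\alpha^{-1}$$ holds true, then there is a constant $c>0$ such that $$\inf_{\widetilde J_n}\ \sup_{f\in\widetilde\Sigma_L}\mathbf P_f\big(\widetilde J_n\ne J_f\big)\ge c,$$ where the infimum is over all possible estimators $\widetilde J_n$ of the sparsity pattern $J_f$.
   Context: Model: one observes $(\boldsymbol X_i,Y_i)$, $i=1,\dots,n$, with $Y_i=f(\boldsymbol X_i)+\varepsilon_i$, where the errors $\varepsilon_i$ are i.i.d. Gaussian with zero mean and variance $1$, with $\mathbf E[\varepsilon_i|\boldsymbol X_i]=0$. Here $d$ is the ambient dimension (number of covariates), $d^*$ is the intrinsic dimension (bound on the number of relevant covariates), $n$ is the sample size, and $\mathbf P_f$ is the law of the observations when the regression function is $f$. Fourier basis: for $\boldsymbol k\in\mathbb Z^d$, $\varphi_{\boldsymbol k}(\boldsymbol x)=1$ if $\boldsymbol k=0$; $\sqrt2\cos(2\pi\,\boldsymbol k\cdot\boldsymbol x)$ if $\boldsymbol k\in(\mathbb Z^d)_+$; $\sqrt2\sin(2\pi\,\boldsymbol k\cdot\boldsymbol x)$ if $-\boldsymbol k\in(\mathbb Z^d)_+$, where $(\mathbb Z^d)_+$ is the set of $\boldsymbol k\in\mathbb Z^d\setminus\{0\}$ whose first nonzero element is positive. Put $\theta_{\boldsymbol k}[f]=\int_{[0,1]^d}f(\boldsymbol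 x)\varphi_{\boldsymbol k}(\boldsymbol x)\,d\boldsymbol x$ and $Q_j[f]=\sum_{\boldsymbol k:\,k_j\ne0}\theta_{\boldsymbol k}[f]^2$. Functional class: for a constant $L>0$, $\widetilde\Sigma_L$ is the set of all functions $f$ such that (i) $\sum_{\boldsymbol k\in\mathbb Z^d}k_j^2\,\theta_{\boldsymbol k}[f]^2\le L$ for all $j\in\{1,\dots,d\}$; and (ii) for some subset $J\subset\{1,\dots,d\}$ of cardinality $\le d^*$ there exists a function $\bar f:\mathbb R^{|J|}\to\mathbb R$ such that $f(\boldsymbol x)=\bar f(\boldsymbol x_J)$ for all $\boldsymbol x\in\mathbb R^d$, and $Q_j[f]\ge1$ for all $j\in J$. This set $J=:J_f$ is called the sparsity pattern of $f$; it is the set of indices $j$ with $Q_j[f]\ne0$.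
   Formalization: The constant L is assumed to satisfy L ≥ 1 instead of L > 0: for 0 < L < 1 the conditions Q_j[f] ≥ 1 and Σ k_j² θ_k² ≤ L force J to be empty, so the estimator ∅ has zero risk and the claim fails. *)

(* Defs.v *)
From HB Require Import structures.
From mathcomp Require Import all_boot all_order all_algebra.
From mathcomp Require Import all_classical all_reals all_analysis.
From mathcomp Require Import measurable_realfun.

Set Implicit Arguments.
Unset Strict Implicit.
Unset Printing Implicit Defensive.

Import Order.TTheory GRing.Theory Num.Theory.
Import numFieldNormedType.Exports.

Local Open Scope classical_set_scope.
Local Open Scope ring_scope.

Section power_probability.
Context {d : measure_display} {T : measurableType d} {R : realType}.

Definition cons_pair n (z : T * n.-tuple T) : n.+1.-tuple T :=
  [tuple of z.1 :: z.2].

Lemma measurable_cons_pair n : measurable_fun setT (@cons_pair n).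
Proof. exact: measurable_cons. Qed.

HB.instance Definition _ n := isMeasurableFun.Build _ _ _ _ (@cons_pair n)
  (@measurable_cons_pair n).

(* The [n]-fold product P (x) ... (x) P on [T^n], i.e. the law of an i.i.d.
   sample of size [n] from [P]; see [power_prob_box]. *)
Fixpoint power_prob (P : probability T R) (n : nat) :
    probability (n.-tuple T) R :=
  match n with
  | 0%N => @dirac _ (0.-tuple T) [tuple] R
  | n'.+1 => distribution (P \x power_prob P n')%E (@cons_pair n')
  end.

Lemma power_prob_box (P : probability T R) n (A : 'I_n -> set T) :
  (forall i, measurable (A i)) ->
  power_prob P n [set t | forall i, A i (tnth t i)] =
  (\prod_(i < n) P (A i))%E.
Proof.
elim: n A => [|n IHn] A mA /=.
  by rewrite big_ord0 diracE mem_set// => -[].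
rewrite big_ord_recl -IHn; last by move=> i; exact: mA.
rewrite -(product_measure1E P (power_prob P n)) //; last first.
  rewrite (_ : [set t | _] =
      \bigcap_(i in [set: 'I_n]) ((@tnth n T ^~ i) @^-1` A (lift ord0 i))).
    apply: fin_bigcap_measurable => // i _.
    by rewrite -[X in measurable X]setTI; exact: (@measurable_tnth _ T).
  by apply/seteqP; split => t /= h i; [move=> _|]; exact: h.
rewrite /distribution /pushforward; congr product_measure1.
apply/seteqP; split => -[x t] /=.
  move=> h; split; first exact: (h ord0).
  by move=> i; have := h (lift ord0 i); rewrite tnthS.
move=> [hx ht] i; case: (unliftP ord0 i) => [j ->|->] //.
by rewrite tnthS; exact: ht.
Qed.

End power_probability.

Section variable_selection.
Context {R : realType}.

(* The library's laws on the real line live on [measurableTypeR R], which has the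
   same carrier and the same measurable sets as [R] but another display. *)
Definition toR : measurableTypeR R -> R := idfun.

Lemma measurable_toR : measurable_fun setT toR.
Proof. exact: (@measurable_id _ _ setT). Qed.

HB.instance Definition _ := isMeasurableFun.Build _ _ _ _ toR measurable_toR.

Definition uniform01 : probability R R :=
  distribution (uniform_prob (@ltr01 R)) toR.

Definition std_normal : probability R R :=
  distribution (normal_prob (0 : R) 1) toR.

(* Lebesgue measure restricted to [0,1]^d, as a measure on [R^d = d.-tuple R]. *)
Definition cube_measure (d : nat) : probability (d.-tuple R) R :=
  power_prob uniform01 d.

Definition Zpos {d} (k : 'rV[int]_d) : bool :=
  [exists j : 'I_d, (0 < k 0 j) && [forall i : 'I_d, (i < j)%N ==> (k 0 i == 0)]].

Definition dotk {d} (k : 'rV[int]_d) (x : d.-tuple R) : R :=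
  \sum_(j < d) (k 0 j)%:~R * tnth x j.

(* The last case is [k != 0] with [~~ Zpos k], that is [Zpos (- k)]. *)
Definition fourier {d} (k : 'rV[int]_d) (x : d.-tuple R) : R :=
  if k == 0 then 1
  else if Zpos k then Num.sqrt 2 * cos (2 * pi * dotk k x)
  else Num.sqrt 2 * sin (2 * pi * dotk k x).

Definition theta {d} (f : d.-tuple R -> R) (k : 'rV[int]_d) : R :=
  \int[cube_measure d]_x (f x * fourier k x).

Definition Q {d} (f : d.-tuple R -> R) (j : 'I_d) : \bar R :=
  \esum_(k in [set k : 'rV[int]_d | k 0 j != 0]) ((theta f k) ^+ 2)%:E.

Definition subvec {d} (J : {set 'I_d}) (x : d.-tuple R) : #|J|.-tuple R :=
  [tuple tnth x (enum_val i) | i < #|J|].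

(* [f] is measurable and square integrable on the cube, so that its Fourier
   coefficients are meaningful. *)
Definition Sigma {d} (dstar : nat) (L : R) : set (d.-tuple R -> R) :=
  [set f : d.-tuple R -> R |
    [/\ measurable_fun [set: d.-tuple R] f,
        (cube_measure d).-integrable setT (fun x => (f x ^+ 2)%:E),
        forall j : 'I_d,
          (\esum_(k in [set: 'rV[int]_d])
             ((k 0 j)%:~R ^+ 2 * theta f k ^+ 2)%:E <= L%:E)%E &
        exists J : {set 'I_d},
          [/\ (#|J| <= dstar)%N,
              exists fbar : #|J|.-tuple R -> R,
                forall x, f x = fbar (subvec J x) &
              forall j, j \in J -> (1 <= Q f j)%E]]].

(* For [f] in [Sigma dstar L] this is the set [J] occurring there: if [f] only
   depends on [x_J] then [Q f j = 0] for every [j] outside of [J]. *)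
Definition sparsity_pattern {d} (f : d.-tuple R -> R) : {set 'I_d} :=
  [set j | Q f j != 0%E]%SET.

Definition regression {n d} (f : d.-tuple R -> R)
    (z : n.-tuple (d.-tuple R) * n.-tuple R) :
    n.-tuple (d.-tuple R) * n.-tuple R :=
  (z.1, [tuple f (tnth z.1 i) + tnth z.2 i | i < n]).

Lemma measurable_regression n d (f : d.-tuple R -> R) :
  measurable_fun setT f -> measurable_fun setT (@regression n d f).
Proof.
move=> mf; apply/measurable_fun_pairP; split => /=; first exact: measurable_fst.
apply/measurable_fun_tnthP => i /=.
rewrite (_ : _ \o _ = (fun z : n.-tuple (d.-tuple R) * n.-tuple R =>
   f (tnth z.1 i) + tnth z.2 i)); last by apply/funext => z /=; rewrite tnth_mktuple.
apply: measurable_funD.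
  apply: (measurableT_comp mf).
  exact: measurableT_comp (@measurable_tnth _ _ _ i) measurable_fst.
exact: measurableT_comp (@measurable_tnth _ _ _ i) measurable_snd.
Qed.

(* Law of the observations ((X_1, ..., X_n), (Y_1, ..., Y_n)).  The law [mu] of
   the whole design is arbitrary (a Dirac mass for a deterministic design), and
   the noise is i.i.d. N(0, 1) and independent of the design. *)
Definition obs_law {n d} (mu : probability (n.-tuple (d.-tuple R)) R)
    (f : d.-tuple R -> R) : set (n.-tuple (d.-tuple R) * n.-tuple R) -> \bar R :=
  pushforward (mu \x power_prob std_normal n)%E (regression f).

Definition design_in_cube {n d} (mu : probability (n.-tuple (d.-tuple R)) R) :=
  mu [set X | forall (i : 'I_n) (j : 'I_d), 0 <= tnth (tnth X i) j <= 1] = 1%E.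

Definition estimators {n d : nat} :
    set (n.-tuple (d.-tuple R) * n.-tuple R -> {set 'I_d}) :=
  [set Jt | forall J : {set 'I_d}, measurable (Jt @^-1` [set J])].

Definition minimax_risk {n d} (mu : probability (n.-tuple (d.-tuple R)) R)
    (dstar : nat) (L : R) : \bar R :=
  ereal_inf [set ereal_sup [set obs_law mu f [set z | Jt z != sparsity_pattern f]
                           | f in @Sigma d dstar L]
            | Jt in @estimators n d].

End variable_selection.

(* Main.v *)
(* For J of cardinality dstar take f_J(x) = sqrt 2 cos(2 pi sum_(j in J) x_j),
   which is the single Fourier basis function indexed by the indicator of [J];
   hence Q_j[f_J] is 1 or 0 according to whether j is in J, and the smoothness
   sums are at most 1 <= L.
   As f_J^2 <= 2, the likelihood ratio LR_J of the observations under f_J with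
   respect to pure noise has second moment at most e^(2n).  Integrating
   [LR_J 1_A <= lam 1_A / 2 + LR_J^2 / (2 lam)] over the disjoint events
   [Jt = J] of an estimator and optimising lam, the sum over the M = 'C(d, dstar)
   patterns of P_(f_J)(Jt = J) is at most e^n sqrt M.  So the average success
   probability is at most e^n / sqrt M, where ln M >= dstar ln(d / dstar) >= n / alpha
   and alpha < 1/2; this second-moment argument replaces Fano's inequality. *)
Require Import Defs.
From HB Require Import structures.
From mathcomp Require Import all_boot all_order all_algebra.
From mathcomp Require Import all_classical all_reals all_analysis.
From mathcomp Require Import measurable_realfun ring lra.
Import Order.TTheory GRing.Theory Num.Theory.
Import numFieldNormedType.Exports.
Local Open Scope classical_set_scope.
Local Open Scope ring_scope.

Set Implicit Arguments.
Unset Strict Implicit.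
Unset Printing Implicit Defensive.

(** * Translates of the Gaussian law *)

Section density.
Local Open Scope ereal_scope.
Context d (T : measurableType d) (R : realType).
Variables (mu nu : {measure set T -> \bar R}) (p : T -> R).
Hypotheses (mp : measurable_fun setT p) (p_ge0 : forall x, (0 <= p x)%R).
Hypothesis nuE : forall A, measurable A -> nu A = \int[mu]_(x in A) (p x)%:E.

Import HBNNSimple.

Let integral_density_indic A : measurable A ->
  \int[nu]_x (\1_A x)%:E = \int[mu]_x ((\1_A x)%:E * (p x)%:E).
Proof.
move=> mA; rewrite integral_indic// setIT nuE// integral_mkcond.
apply: eq_integral => x _; rewrite patchE indicE.
by case: ifP => _; rewrite ?mul1e ?mul0e.
Qed.

Let integral_density_nnsfun (f : {nnsfun T >-> R}) :
  \int[nu]_x (f x)%:E = \int[mu]_x ((f x)%:E * (p x)%:E).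
Proof.
under [LHS]eq_integral do rewrite fimfunE -fsumEFin//.
rewrite [LHS]ge0_integral_fsum//; last 2 first.
  - by move=> r; exact/measurable_EFinP/measurableT_comp.
  - by move=> r x _; rewrite EFinM nnfun_muleindic_ge0.
transitivity (\sum_(r \in range f)
    \int[mu]_x ((r * \1_(f @^-1` [set r]) x)%:E * (p x)%:E)).
  (* A negative [r] is not a value of [f], so its level set is empty and both integrals vanish; the
     constant is pulled out only when [r] is nonnegative. *)
  apply: eq_fsbigr => r _; have [r_ge0|r_lt0] := leP 0%R r.
    rewrite integralZl_indic_nnsfun// integral_indic// setIT.
    have -> : nu (f @^-1` [set r]) = \int[nu]_x (\1_(f @^-1` [set r]) x)%:E.
      by rewrite integral_indic// setIT.
    rewrite integral_density_indic// -ge0_integralZl//.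
    - by under eq_integral do rewrite muleA -EFinM.
    - by apply: emeasurable_funM; exact/measurable_EFinP.
    - by move=> x _; rewrite mule_ge0// lee_fin.
  have -> : f @^-1` [set r] = set0 by exact: preimage_nnfun0.
  rewrite !integral0_eq// => x _; rewrite indic0 mulr0 ?mul0e//.
rewrite -ge0_integral_fsum//; last 2 first.
  - move=> r; apply: emeasurable_funM; last exact/measurable_EFinP.
    exact/measurable_EFinP/measurableT_comp.
  - move=> r x _; apply: mule_ge0; last by rewrite lee_fin.
    by rewrite EFinM nnfun_muleindic_ge0.
apply: eq_integral => x _; rewrite [in RHS]fimfunE -fsumEFin//.
by rewrite ge0_mule_fsuml// => r; rewrite EFinM nnfun_muleindic_ge0.
Qed.

(** The identity passes from indicators to simple functions by linearity, and from these to [f] by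
    monotone convergence. *)
Lemma ge0_integral_density (f : T -> \bar R) : measurable_fun setT f ->
  (forall x, 0 <= f x) -> \int[nu]_x f x = \int[mu]_x (f x * (p x)%:E).
Proof.
move=> mf f_ge0; pose f_ := nnsfun_approx measurableT mf.
have nd_f_ x : {homo (fun n => (f_ n x)%:E) : m n / (m <= n)%N >-> m <= n}.
  by move=> m n mn; rewrite lee_fin; exact/lefP/nd_nnsfun_approx.
transitivity (limn (fun n => \int[nu]_x (f_ n x)%:E)).
  rewrite -monotone_convergence//.
  - by apply: eq_integral => x _; apply/esym/cvg_lim => //; exact: cvg_nnsfun_approx.
  - by move=> n; exact/measurable_EFinP.
  - by move=> n x _; rewrite lee_fin.
under eq_fun do rewrite integral_density_nnsfun.
rewrite -monotone_convergence//.
- apply: eq_integral => x _; apply/cvg_lim => //.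
  by apply: cvgeZr => //; exact: cvg_nnsfun_approx.
- by move=> n; apply: emeasurable_funM; exact/measurable_EFinP.
- by move=> n x _; rewrite mule_ge0// lee_fin.
- by move=> x _ m n mn; rewrite lee_wpmul2r ?lee_fin// -lee_fin nd_f_.
Qed.

End density.

(** * Translation invariance and the Gaussian shift on the line *)

Section gaussian_shift.
Context {R : realType}.
Local Notation leb := (@lebesgue_measure R).

Let addr_fun (a : R) (x : measurableTypeR R) : measurableTypeR R := x + a.

Let measurable_addr_fun a : measurable_fun setT (addr_fun a).
Proof. exact: measurable_funD. Qed.

HB.instance Definition _ a := isMeasurableFun.Build _ _ _ _ (addr_fun a)
  (measurable_addr_fun a).

(** Lebesgue measure is determined by its values on half-open intervals, and translating an interval
    keeps its length. *)
Lemma lebesgue_measureD (a : R) (A : set R) : measurable A ->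
  pushforward leb (addr_fun a) A = leb A.
Proof.
move=> mA; apply/esym.
apply: (lebesgue_measure_unique (mu := pushforward leb (addr_fun a))) => //.
move=> _ [[b c]] _ <-; rewrite /pushforward.
rewrite [X in _ = leb X](_ : _ = `](b - a), (c - a)]%classic); last first.
  by apply/seteqP; split=> x /=; rewrite !in_itv/= ltrBlDr lerBrDr.
by rewrite !lebesgue_measure_itv/= !lte_fin ltrD2r -!EFinD opprB addrA subrK.
Qed.

Lemma ge0_integral_lebesgueD (a : R) (f : R -> \bar R) :
  measurable_fun setT f -> (forall x, 0 <= f x)%E ->
  (\int[leb]_x f (x + a)%R = \int[leb]_x f x)%E.
Proof.
move=> mf f_ge0.
rewrite -[LHS](ge0_integral_pushforward (measurable_addr_fun a) leb (D := setT)
  (f := f))//.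
by apply: eq_measure_integral => A mA _; exact: lebesgue_measureD.
Qed.

Lemma ge0_integral_std_normal (f : R -> \bar R) :
  measurable_fun setT f -> (forall x, 0 <= f x)%E ->
  (\int[std_normal]_x f x = \int[leb]_x (f x * (normal_pdf 0 1 x)%:E))%E.
Proof.
move=> mf f_ge0; rewrite ge0_integral_distribution//=.
have mpdf := measurable_normal_pdf (0 : R) 1.
exact: (@ge0_integral_density _ (measurableTypeR R) R leb (normal_prob 0 1)
  _ mpdf (normal_pdf_ge0 0 1)).
Qed.

(** One-dimensional Cameron-Martin formula: the ratio of [normal_pdf 0 1 (x - v)] to
    [normal_pdf 0 1 x] is e^(v x - v^2 / 2). *)
Lemma ge0_integral_std_normalD (v : R) (f : R -> \bar R) :
  measurable_fun setT f -> (forall x, 0 <= f x)%E ->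
  (\int[std_normal]_x f (v + x)%R
   = \int[std_normal]_x (f x * (expR (v * x - v ^+ 2 / 2)%R)%:E))%E.
Proof.
move=> mf f_ge0.
have mpdf := measurable_normal_pdf (0 : R) 1.
rewrite ge0_integral_std_normal//; last first.
  by apply: (measurableT_comp mf); exact: measurable_funD.
(* With the density recentred, [g (x + v)] is the whole integrand, so translation invariance removes
   the shift. *)
pose g x := (f x * (normal_pdf 0 1 (x - v))%:E)%E.
transitivity (\int[leb]_x g (x + v)%R)%E.
  by apply: eq_integral => x _; rewrite /g addrK addrC.
rewrite ge0_integral_lebesgueD; last 2 first.
- apply: emeasurable_funM => //; apply/measurable_EFinP.
  by apply: (measurableT_comp mpdf); exact: measurable_funB.
- by move=> x; rewrite mule_ge0// lee_fin normal_pdf_ge0.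
rewrite ge0_integral_std_normal; last 2 first.
- apply: emeasurable_funM => //; apply/measurable_EFinP/measurableT_comp => //.
  by apply: measurable_funB => //; exact: measurable_funM.
- by move=> x; rewrite mule_ge0// lee_fin expR_ge0.
apply: eq_integral => x _; rewrite /g -muleA -EFinM.
rewrite !normal_pdfE ?oner_neq0// mulrCA /normal_fun -expRD.
congr (_ * (_ * expR _)%:E)%E.
by field.
Qed.

End gaussian_shift.

(** * The Gaussian shift in dimension [n] and its second moment *)

Section gaussian_shift_vector.
Context {R : realType}.

(** Tonelli with the first coordinate split off, the form needed for inductions on the number of
    coordinates. *)
Lemma ge0_integral_power_prob d (T : measurableType d) (P : probability T R) n
    (f : n.+1.-tuple T -> \bar R) :
  measurable_fun setT f -> (forall x, 0 <= f x)%E ->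
  (\int[power_prob P n.+1]_x f x
   = \int[P]_x \int[power_prob P n]_y f (cons_pair (x, y)))%E.
Proof.
move=> mf f_ge0; rewrite /= ge0_integral_distribution//.
rewrite fubini_tonelli1//; last by move=> z; exact: f_ge0.
exact: measurableT_comp mf (@measurable_cons_pair _ T n).
Qed.

Definition translate n (v y : n.-tuple R) : n.-tuple R :=
  [tuple tnth v i + tnth y i | i < n].

(* The likelihood ratio at [y] of N(v, I_n) with respect to N(0, I_n). *)
Definition translate_density n (v y : n.-tuple R) : R :=
  expR (\sum_(i < n) (tnth v i * tnth y i - tnth v i ^+ 2 / 2)).

Lemma measurable_translate n (v : n.-tuple R) : measurable_fun setT (translate v).
Proof.
apply/measurable_fun_tnthP => i.
rewrite (_ : _ \o _ = fun y : n.-tuple R => tnth v i + tnth y i); last first.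
  by apply/funext => y /=; rewrite tnth_mktuple.
by apply: measurable_funD => //; exact: measurable_tnth.
Qed.

Lemma measurable_translate_density n (v : n.-tuple R) :
  measurable_fun setT (translate_density v).
Proof.
apply: measurableT_comp => //; apply: measurable_sum => i.
apply: measurable_funB => //; apply: measurable_funM => //.
exact: measurable_tnth.
Qed.

Lemma translate_cons n (a x : R) (v y : n.-tuple R) :
  translate (cons_pair (a, v)) (cons_pair (x, y)) = cons_pair (a + x, translate v y).
Proof.
apply/eq_from_tnth => i; rewrite tnth_mktuple.
by case: (unliftP ord0 i) => [j ->|->] //; rewrite !tnthS tnth_mktuple.
Qed.

Lemma translate_density_cons n (a x : R) (v y : n.-tuple R) :
  translate_density (cons_pair (a, v)) (cons_pair (x, y))
  = expR (a * x - a ^+ 2 / 2) * translate_density v y.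
Proof.
rewrite /translate_density big_ord_recl expRD; congr (_ * expR _).
by apply: eq_bigr => i _; rewrite !tnthS.
Qed.

(** The density factorises over coordinates, so the induction hypothesis shifts the tail and the
    one-dimensional formula shifts the head. *)
Lemma ge0_integral_translate n (v : n.-tuple R) (f : n.-tuple R -> \bar R) :
  measurable_fun setT f -> (forall x, 0 <= f x)%E ->
  (\int[power_prob std_normal n]_y f (translate v y)
   = \int[power_prob std_normal n]_y (f y * (translate_density v y)%:E))%E.
Proof.
elim: n v f => [|n IHn] v f mf f_ge0.
  have mv := measurable_translate v; have md := measurable_translate_density v.
  rewrite /= !integral_dirac//=.
  - rewrite /translate_density big_ord0 expR0 mule1; congr (_ * f _)%E.
    by apply/eq_from_tnth => -[].
  - by apply: emeasurable_funM => //; exact/measurable_EFinP.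
  - exact: measurableT_comp mf mv.
case/tupleP: v => a w; set v := [tuple of a :: w].
have md := measurable_translate_density v.
rewrite ge0_integral_power_prob//; last first.
  exact: measurableT_comp mf (measurable_translate v).
rewrite ge0_integral_power_prob//; last 2 first.
- by apply: emeasurable_funM => //; exact/measurable_EFinP.
- by move=> x; rewrite mule_ge0// lee_fin expR_ge0.
(* [G] is the tail integral, already reweighted, as a function of the first coordinate; only the
   shift of that coordinate then remains. *)
pose G x := (\int[power_prob std_normal n]_y
  (f (cons_pair (x, y)) * (translate_density w y)%:E))%E.
have mfc : measurable_fun setT (fun z : R * n.-tuple R => f (cons_pair z)).
  exact: measurableT_comp mf (@measurable_cons_pair _ _ _).
have mG : measurable_fun setT G.
  apply: (measurable_fun_fubini_tonelli_F
      (fun z : R * n.-tuple R => f (cons_pair z) * (translate_density w z.2)%:E)%E).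
  - apply: emeasurable_funM => //; apply/measurable_EFinP.
    exact: measurableT_comp (measurable_translate_density w) measurable_snd.
  - by move=> z; rewrite mule_ge0// lee_fin expR_ge0.
transitivity (\int[std_normal]_x G (a + x)%R)%E.
  apply: eq_integral => x _; under eq_integral do rewrite (translate_cons a).
  rewrite (IHn w (fun y => f (cons_pair ((a + x)%R, y))))//.
  exact: measurableT_comp mfc (measurable_pair1 _).
rewrite (ge0_integral_std_normalD a mG); last first.
  by move=> x; apply: integral_ge0 => y _; rewrite mule_ge0// lee_fin expR_ge0.
apply: eq_integral => x _; rewrite /G -ge0_integralZr//.
- apply: eq_integral => y _; rewrite (translate_density_cons a) -muleA -EFinM.
  by rewrite [(translate_density _ _ * _)%R]mulrC.
- apply: emeasurable_funM.
    exact: measurableT_comp mfc (measurable_pair1 _).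
  by apply/measurable_EFinP; exact: measurable_translate_density.
- by move=> y _; rewrite mule_ge0// lee_fin expR_ge0.
Qed.

(** One factor of the square acts as a change of measure that shifts the other: LR(v + y) =
    e^(|v|^2) LR(y), and LR has integral 1. *)
Lemma integral_sqr_translate_density n (v : n.-tuple R) :
  (\int[power_prob std_normal n]_y (translate_density v y ^+ 2)%:E
   = (expR (\sum_(i < n) tnth v i ^+ 2))%:E)%E.
Proof.
have md := measurable_translate_density v.
under eq_integral do rewrite expr2 EFinM.
rewrite -(ge0_integral_translate v
  (f := fun y => (translate_density v y)%:E)); last 2 first.
- exact/measurable_EFinP.
- by move=> y; rewrite lee_fin expR_ge0.
transitivity (\int[power_prob std_normal n]_y
   ((expR (\sum_(i < n) tnth v i ^+ 2))%:E * (1 * (translate_density v y)%:E)))%E.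
  apply: eq_integral => y _; rewrite mul1e -EFinM -expRD -big_split/=.
  congr (expR _)%:E; apply: eq_bigr => i _; rewrite tnth_mktuple; ring.
rewrite ge0_integralZl//; last 2 first.
- by apply: emeasurable_funM => //; exact/measurable_EFinP.
- by move=> y _; rewrite mul1e lee_fin expR_ge0.
rewrite -(ge0_integral_translate v (f := cst 1%E))// integral_cst// mul1e.
by rewrite [X in (_ * X)%E]probability_setT mule1.
Qed.

(* AM-GM, [LR 1_A <= lam 1_A / 2 + LR^2 / (2 lam)], integrated against N(0, I_n). *)
Lemma power_prob_translate_le n (v : n.-tuple R) (A : set (n.-tuple R)) (lam : R) :
  measurable A -> 0 < lam ->
  (power_prob std_normal n (translate v @^-1` A)
   <= (lam / 2)%:E * power_prob std_normal n A
      + (expR (\sum_(i < n) tnth v i ^+ 2) / (2 * lam))%:E)%E.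
Proof.
move=> mA lam_gt0.
have md := measurable_translate_density v.
have mA1 : measurable_fun setT (fun y => (\1_A y : R)%:E) by exact/measurable_EFinP.
have mSA : measurable (translate v @^-1` A).
  by rewrite -[X in measurable X]setTI; exact: measurable_translate.
have -> : power_prob std_normal n (translate v @^-1` A)
    = (\int[power_prob std_normal n]_y ((\1_A y)%:E * (translate_density v y)%:E))%E.
  rewrite -ge0_integral_translate//.
  transitivity (\int[power_prob std_normal n]_y (\1_(translate v @^-1` A) y)%:E)%E => //.
  by rewrite integral_indic// setIT.
have -> : power_prob std_normal n A
    = (\int[power_prob std_normal n]_y (\1_A y)%:E)%E.
  by rewrite integral_indic// setIT.
have msq : measurable_fun setT (fun y => (translate_density v y ^+ 2)%:E).
  by apply/measurable_EFinP; exact: measurable_funX.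
(* The exponential is turned back into the integral of the squared density, so that a pointwise
   inequality suffices. *)
rewrite [X in (_ + X%:E)%E]mulrC [X in (_ + X)%E]EFinM.
rewrite -(integral_sqr_translate_density v).
rewrite -[X in (X + _)%E]ge0_integralZl//; last by rewrite lee_fin divr_ge0// ltW.
rewrite -[X in (_ + X)%E]ge0_integralZl//; last 2 first.
- by move=> y _; rewrite lee_fin sqr_ge0.
- by rewrite lee_fin invr_ge0 mulr_ge0// ltW.
rewrite -ge0_integralD//; last 4 first.
- by move=> y _; rewrite mule_ge0// lee_fin// divr_ge0// ltW.
- exact: measurable_funeM.
- by move=> y _; rewrite mule_ge0// lee_fin ?sqr_ge0// invr_ge0 mulr_ge0// ltW.
- exact: measurable_funeM.
apply: ge0_le_integral => //.
- by move=> y _; rewrite mule_ge0// lee_fin expR_ge0.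
- by apply: emeasurable_funM => //; exact/measurable_EFinP.
- by apply: emeasurable_funD; exact: measurable_funeM.
move=> y _; rewrite -!EFinM -EFinD lee_fin; set r := translate_density v y.
rewrite indicE; case: (y \in A); last first.
  by rewrite mul0r mulr0 add0r mulr_ge0 ?sqr_ge0// invr_ge0 mulr_ge0// ltW.
rewrite mul1r mulr1 -subr_ge0.
have -> : lam / 2 + (2 * lam)^-1 * r ^+ 2 - r = (r - lam) ^+ 2 / (2 * lam).
  by field; rewrite gt_eqF.
by rewrite divr_ge0 ?sqr_ge0// mulr_ge0// ltW.
Qed.

End gaussian_shift_vector.

(** * Testing many sparsity patterns *)

Section testing.
Context {R : realType} {n d : nat}.
Variable mu : probability (n.-tuple (d.-tuple R)) R.
Local Notation gauss := (power_prob (@std_normal R) n).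
Local Notation obs := (n.-tuple (d.-tuple R) * n.-tuple R)%type.

(** Given the design [X], the responses have law N(v, I_n) with v = (f(X_1), ..., f(X_n)), and |v|^2
    <= 2n whatever [X] is. The bound for fixed [X] is then integrated over [mu]. *)
Lemma obs_law_le (f : d.-tuple R -> R) (B : set obs) (lam : R) :
  measurable_fun setT f -> (forall x, f x ^+ 2 <= 2) ->
  measurable B -> 0 < lam ->
  (obs_law mu f B
   <= (lam / 2)%:E * (mu \x gauss) B + (expR (2 * n%:R) / (2 * lam))%:E)%E.
Proof.
move=> mf f_le mB lam_gt0; pose c := expR (2 * n%:R) / (2 * lam).
have mrB : measurable (regression f @^-1` B).
  by rewrite -[X in measurable X]setTI; exact: measurable_regression.
have c_ge0 : (0 <= c%:E)%E by rewrite lee_fin divr_ge0 ?expR_ge0// mulr_ge0// ltW.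
have lam2_ge0 : (0 <= (lam / 2)%:E :> \bar R)%E by rewrite lee_fin divr_ge0// ltW.
have mxB : measurable_fun setT (gauss \o xsection B).
  exact: measurable_fun_xsection.
rewrite /obs_law /pushforward /product_measure1.
rewrite -ge0_integralZl//.
have -> : c%:E = (\int[mu]_X cst c%:E X)%E.
  by rewrite integral_cst//; last rewrite [X in (_ * X)%E]probability_setT mule1.
rewrite -ge0_integralD//; last 2 first.
- by move=> X _; rewrite mule_ge0.
- exact: measurable_funeM.
apply: ge0_le_integral => //.
- exact: measurable_fun_xsection.
- by apply: emeasurable_funD => //; exact: measurable_funeM.
move=> X _ /=.
have -> : xsection (regression f @^-1` B) X
    = translate (map_tuple f X) @^-1` xsection B X.
  apply/seteqP; split=> y; rewrite /xsection /= !inE /regression /=;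
    by congr (B (_, _)); apply/eq_from_tnth => i; rewrite !tnth_mktuple tnth_map.
apply: (le_trans (power_prob_translate_le _ (measurable_xsection _ mB) lam_gt0)).
rewrite leeD2l// lee_fin ler_pM2r ?invr_gt0 ?mulr_gt0// ler_expR.
rewrite (le_trans (y := \sum_(i < n) 2))//.
  by apply: ler_sum => i _; rewrite tnth_map.
by rewrite sumr_const card_ord mulr_natr.
Qed.

Lemma sum_obs_law_le (S : {set {set 'I_d}}) (f : {set 'I_d} -> d.-tuple R -> R)
    (Jt : obs -> {set 'I_d}) :
  (0 < #|S|)%N ->
  (forall J, measurable_fun setT (f J)) -> (forall J x, f J x ^+ 2 <= 2) ->
  estimators Jt ->
  (\sum_(J in S) obs_law mu (f J) (Jt @^-1` [set J])
   <= (Num.sqrt #|S|%:R * expR n%:R)%:E)%E.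
Proof.
(* This [lam] makes the two terms of the summed bound, [lam / 2] and
   [#|S|%:R * expR (2 * n%:R) / (2 * lam)], equal. *)
move=> S_gt0 mf f_le mJt; set lam := Num.sqrt _ * _.
have sqrtS_gt0 : 0 < Num.sqrt #|S|%:R :> R by rewrite sqrtr_gt0 ltr0n.
have lam_gt0 : 0 < lam by rewrite mulr_gt0 ?expR_gt0.
pose P := (mu \x gauss)%E.
pose c := expR (2 * n%:R) / (2 * lam).
apply: (le_trans (y := \sum_(J in S) ((lam / 2)%:E * P (Jt @^-1` [set J]) + c%:E))%E).
  by apply: lee_sum => J _; exact: obs_law_le.
rewrite big_split/= -ge0_sume_distrr//.
have sumP : (\sum_(J in S) P (Jt @^-1` [set J]) <= 1)%E.
  have mJtS : forall Q : pred {set 'I_d}, measurable (Jt @^-1` [set` Q]).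
    move=> Q; have -> : Jt @^-1` [set` Q] = \bigcup_(J in [set` Q]) (Jt @^-1` [set J]).
      apply/seteqP; split=> z /=; first by move=> Qz; exists (Jt z).
      by move=> [J QJ /= ->].
    by apply: fin_bigcup_measurable => // J _; exact: mJt.
  have -> : (\sum_(J in S) P (Jt @^-1` [set J]) = P (Jt @^-1` [set` mem (enum S)]))%E.
    (* Additivity by induction on the duplicate-free list [enum S]: distinct values of [Jt] give
       disjoint events. *)
    rewrite -big_enum/=; elim: (enum S) (enum_uniq S) => [_|J s IHs /andP[Js us]].
      by rewrite big_nil (_ : _ @^-1` _ = set0) ?measure0//; apply/seteqP; split.
    rewrite big_cons IHs// -measureU//.
    - congr (P _); apply/seteqP; split=> z /=; rewrite inE.
        by case=> [->|->]; rewrite ?eqxx ?orbT.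
      by case/orP => [/eqP|]; [left|right].
    - exact: (mJtS (mem s)).
    - by apply/seteqP; split=> // z /= [-> Jin]; rewrite Jin in Js.
  exact: probability_le1 (mJtS _).
rewrite (le_trans (leeD2r _ (lee_wpmul2l _ sumP)))//.
  by rewrite lee_fin divr_ge0// ltW.
rewrite mule1 sumEFin -EFinD lee_fin sumr_const -[c *+ _]mulr_natl.
have -> : #|S|%:R * c = lam / 2.
  rewrite /c -[X in X * _](sqr_sqrtr (ler0n R #|S|)) mulr_natl mulr2n expRD /lam.
  by field; rewrite !gt_eqF ?expR_gt0.
by rewrite -splitr.
Qed.

Lemma obs_law_setC (f : d.-tuple R -> R) (B : set obs) :
  measurable_fun setT f -> measurable B ->
  (obs_law mu f B + obs_law mu f (~` B) = 1)%E.
Proof.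
move=> mf mB; rewrite /obs_law /pushforward.
have mrB : measurable (regression f @^-1` B).
  by rewrite -[X in measurable X]setTI; exact: measurable_regression.
rewrite (_ : regression f @^-1` (~` B) = ~` (regression f @^-1` B))//.
rewrite -measureU//; last 2 first.
- exact: measurableC.
- exact: setICr.
by rewrite setUv; exact: probability_setT.
Qed.

(** For each [J] in [S], the worst-case error plus the success probability under [f J] is at least
    1. Summing over [S], inserting [sum_obs_law_le] and dividing by [#|S|] gives the bound. *)
Lemma minimax_risk_ge (S : {set {set 'I_d}}) (f : {set 'I_d} -> d.-tuple R -> R)
    (dstar : nat) (L : R) :
  (0 < #|S|)%N ->
  (forall J, measurable_fun setT (f J)) -> (forall J x, f J x ^+ 2 <= 2) ->
  (forall J, J \in S -> Sigma dstar L (f J)) ->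
  (forall J, J \in S -> sparsity_pattern (f J) = J) ->
  ((1 - expR n%:R / Num.sqrt #|S|%:R)%:E <= minimax_risk mu dstar L)%E.
Proof.
move=> S_gt0 mf f_le fS fJ; apply/ereal_infP => _ [Jt mJt <-].
set s := ereal_sup _.
have s_ge J : J \in S -> (1 <= s + obs_law mu (f J) (Jt @^-1` [set J]))%E.
  move=> JS; rewrite -(obs_law_setC (mf J) (mJt J)) addeC leeD2l//.
  apply: ereal_sup_ubound; exists (f J); first exact: fS.
  rewrite fJ//; congr (obs_law _ _ _); apply/seteqP; split=> z /=.
    by move/eqP.
  by move=> h; apply/eqP.
(* This excludes the value [-oo] for [s]; the value [+oo] is trivial, which leaves real
   arithmetic. *)
have s_ge0 : (0 <= s)%E.
  have [J JS] := card_gt0P S_gt0.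
  apply: (@le_trans _ _ (obs_law mu (f J) [set z | Jt z != sparsity_pattern (f J)])).
    by rewrite /obs_law /pushforward measure_ge0.
  by apply: ereal_sup_ubound; exists (f J); first exact: fS.
have := sum_obs_law_le S_gt0 mf f_le mJt.
have : (\sum_(J in S) 1 <= \sum_(J in S) (s + obs_law mu (f J) (Jt @^-1` [set J])))%E.
  exact: lee_sum.
rewrite big_split/= => h1 /(leeD2l (\sum_(J in S) s))%E /(le_trans h1) {h1}.
case: s s_ge0 {s_ge} => [s _|_ _|//]; last by rewrite leey.
rewrite !sumEFin -EFinD !lee_fin !sumr_const -[1 *+ _]/(#|S|%:R) => h.
have sqrtS_gt0 : 0 < Num.sqrt #|S|%:R :> R by rewrite sqrtr_gt0 ltr0n.
rewrite lerBlDr -(ler_pM2l sqrtS_gt0) -(ler_pM2l sqrtS_gt0).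
rewrite mulr1 -expr2 mulrA -expr2 sqr_sqrtr// mulrDr.
apply: (le_trans h); rewrite mulr_natl lerD2l.
rewrite -[X in _ <= X * _](sqr_sqrtr (ler0n R #|S|)) expr2 mulrCA mulfK ?gt_eqF//.
by rewrite mulrC.
Qed.

End testing.

(** * Lower bound on the number of patterns, and the numerical comparison *)

Lemma expn_leq_bin (d k : nat) : (k <= d)%N -> (d ^ k <= 'C(d, k) * k ^ k)%N.
Proof.
elim: k d => [|k IHk] [|d]//; rewrite ?bin0// ltnS => kd.
(* [mul_bin_diag] lets a factor [d.+1] cancel. After multiplication by [k ^ k] the induction
   hypothesis applies, and what is left is [d.+1 * k <= d * k.+1], that is [k <= d]. *)
rewrite expnS [(k.+1 ^ k.+1)%N]expnS mulnA [('C(_, _) * _)%N]mulnC -mul_bin_diag -mulnA.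
rewrite leq_mul2l /= -(leq_pmul2l (_ : 0 < k ^ k)%N); last first.
  by rewrite expn_gt0; case: k {IHk kd}.
rewrite mulnA [(k ^ k * 'C(_, _))%N]mulnC.
apply: (@leq_trans ((d * k.+1) ^ k)); last by rewrite expnMn leq_mul2r IHk// orbT.
rewrite -expnMn; case: k {IHk} kd => // k kd; rewrite leq_exp2r//.
by rewrite [(k.+1 * _)%N]mulnC [(d * _)%N]mulnS mulSn leq_add2r.
Qed.

Lemma ln_bin_ge (R : realType) (d k : nat) : (0 < k <= d)%N ->
  k%:R * (ln d%:R - ln k%:R) <= ln ('C(d, k)%:R : R).
Proof.
move=> /andP[k_gt0 kd]; have d_gt0 := leq_trans k_gt0 kd.
rewrite mulrBr lerBlDr !mulr_natl -!lnXn ?ltr0n//.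
rewrite -lnM ?posrE ?exprn_gt0 ?ltr0n ?bin_gt0//.
rewrite ler_ln ?posrE ?mulr_gt0 ?exprn_gt0 ?ltr0n ?bin_gt0//.
by rewrite -!natrX -natrM ler_nat expn_leq_bin.
Qed.

(** Since 3 < 4, [ln 3 < 2 * ln 2], which puts the threshold below one half. *)
Lemma alpha_lt_half (R : realType) (alpha : R) :
  alpha < (ln 3 - ln 2) / ln 3 -> alpha < 2^-1.
Proof.
have l3 : 0 < ln 3 :> R by rewrite ln_gt0// ltr1n.
move=> /lt_trans; apply; rewrite ltr_pdivrMr// ltrBlDr.
have : ln 3 < ln (2 * 2) :> R by rewrite ltr_ln ?posrE//; lra.
rewrite lnM ?posrE//; lra.
Qed.

(** With the root written as e^(ln C(d, k) / 2), the quotient is at most e^(n (1 - 1 / (2 alpha))).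
    The bracket is negative and [n] is at least 1, hence a bound free of [n], [d] and [k]. *)
Lemma expR_div_sqrt_le (R : realType) (alpha : R) (n d k : nat) :
  0 < alpha -> alpha < (ln 3 - ln 2) / ln 3 ->
  (0 < n)%N -> (0 < k <= d)%N ->
  alpha^-1 <= k%:R * (ln d%:R - ln k%:R) / n%:R ->
  expR n%:R / Num.sqrt 'C(d, k)%:R <= expR (1 - (2 * alpha)^-1) :> R.
Proof.
move=> a_gt0 /alpha_lt_half a_lt n_gt0 kd aM; have /andP[k_gt0 k_le_d] := kd.
have M_gt0 : 0 < 'C(d, k)%:R :> R by rewrite ltr0n bin_gt0.
have n1 : 1 <= n%:R :> R by rewrite ler1n.
have lnM : alpha^-1 * n%:R <= ln ('C(d, k)%:R : R).
  rewrite (le_trans _ (ln_bin_ge _ kd))// -ler_pdivlMr//.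
  by rewrite (lt_le_trans _ n1).
have -> : Num.sqrt 'C(d, k)%:R = expR (ln ('C(d, k)%:R : R) / 2).
  rewrite -[in LHS](lnK (x := 'C(d, k)%:R : R)) ?posrE//.
  by rewrite {1}(splitr (ln _)) expRD -expr2 sqrtr_sqr ger0_norm// expR_ge0.
have a2 : 2 < alpha^-1 by rewrite -[ltLHS]invrK ltf_pV2// posrE.
rewrite -expRN -expRD ler_expR invfM; nra.
Qed.

(** * Fourier test functions *)

Section fourier.
Context {R : realType}.

Lemma sinD2pi_int (m : int) (x : R) : sin (x + 2 * pi * m%:~R) = sin x.
Proof.
have sinDn (n : nat) y : sin (y + 2 * pi * n%:R) = sin y :> R.
  by rewrite mulr_natr mulr_natl periodicn//; exact: sinD2pi.
case: m => n; first exact: sinDn.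
by rewrite NegzE mulrNz mulrN -[in RHS](subrK (2 * pi * n.+1%:R) x) sinDn.
Qed.

Lemma cosD1_ge0 (x : R) : 0 <= 1 + cos x.
Proof. by rewrite -lerBlDl sub0r cos_geN1. Qed.

(* Integrating [1 + cos] instead of [cos] keeps the integrand nonnegative, so that
   the pushforward and Tonelli lemmas need no integrability. *)
Lemma integral_uniform01_cosD1 (m : int) (c : R) :
  (\int[uniform01]_x (1 + cos (2 * pi * (m%:~R * x) + c))%:E
   = (1 + (if m == 0 then cos c else 0))%:E)%E.
Proof.
pose a : R := 2 * pi * m%:~R; pose f (x : R) : R := 1 + cos (a * x + c).
have cf : continuous f.
  move=> x; apply: cvgD; first exact: cvg_cst.
  apply: (cvg_comp _ cos); last exact: continuous_cos.
  apply: cvgD; last exact: cvg_cst.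
  by apply: cvgM; [exact: cvg_cst|exact: cvg_id].
have mf : measurable_fun setT (EFin \o f).
  by apply/measurable_EFinP; exact: continuous_measurable_fun.
have f_ge0 x : (0 <= (EFin \o f) x)%E by rewrite lee_fin cosD1_ge0.
transitivity (\int[uniform01]_x (EFin \o f) x)%E.
  by apply: eq_integral => x _; rewrite /f /a /= mulrA.
rewrite ge0_integral_distribution//= integral_uniform//= subr0 invr1 mul1e.
(* A zero frequency makes the integrand constant; it is treated apart because the antiderivative [F]
   divides by [a]. *)
have [m0|m_neq0] := eqVneq m 0.
  rewrite (eq_integral (cst (1 + cos c)%:E)); last first.
    by move=> x _; rewrite /f /a m0 mulr0 mul0r add0r.
  by rewrite integral_cst//= lebesgue_measure_itv/= lte_fin ltr01 oppr0 adde0 mule1.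
have a_neq0 : a != 0 by rewrite !mulf_neq0 ?intr_eq0// gt_eqF ?pi_gt0.
pose F (x : R) := x + a^-1 * sin (a * x + c).
have dF (x : R) : is_derive x (1 : R) (F : R -> R) (f x).
  rewrite /F /f; apply: is_derive_eq.
  rewrite !scaler1 ?scaler0 ?add0r ?addr0.
  by rewrite /GRing.scale /= mulrCA mulVf ?mulr1.
have cF : continuous F.
  move=> x; apply: differentiable_continuous; apply/derivable1_diffP.
  exact: ex_derive.
rewrite (continuous_FTC2 (F := F))//.
(* As [a] is an integer multiple of [2 * pi], the sine terms at the two endpoints cancel. *)
- by rewrite /F mulr1 mulr0 !add0r [a + c]addrC /a sinD2pi_int -EFinB addrK addr0.
- exact/continuous_subspaceT.
- split.
  + by move=> x _; apply: ex_derive.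
  + exact/cvg_at_right_filter/cF.
  + exact/cvg_at_left_filter/cF.
- by move=> x _; rewrite derive1E; apply: derive_val.
Qed.

Lemma measurable_cos_tuple d (m : 'I_d -> int) (c : R) :
  measurable_fun [set: d.-tuple R]
    (fun x => cos (2 * pi * (\sum_(j < d) (m j)%:~R * tnth x j) + c)).
Proof.
apply: measurableT_comp; first by apply: continuous_measurable_fun; exact: continuous_cos.
apply: measurable_funD => //; apply: measurable_funM => //.
apply: measurable_sum => j; apply: measurable_funM => //.
exact: measurable_tnth.
Qed.

(** The phase [c] is arbitrary so that, in the induction on [d], the first coordinate can be
    absorbed into the phase of the inner integral. *)
Lemma integral_cube_cosD1 d (m : 'I_d -> int) (c : R) :
  (\int[cube_measure d]_x
     (1 + cos (2 * pi * (\sum_(j < d) (m j)%:~R * tnth x j)%R + c))%:E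
   = (1 + (if [forall j, m j == 0] then cos c else 0))%:E)%E.
Proof.
have mf d' (m' : 'I_d' -> int) c' : measurable_fun setT (fun x : d'.-tuple R =>
    (1 + cos (2 * pi * (\sum_(j < d') (m' j)%:~R * tnth x j) + c'))%:E).
  by apply/measurable_EFinP/measurable_funD => //; exact: measurable_cos_tuple.
elim: d m c => [|d IHd] m c.
  rewrite /cube_measure /= integral_dirac//=; last exact: mf.
  rewrite [X in (X * _)%E]probability_setT mul1e.
  by rewrite big_ord0 mulr0 add0r ifT//; apply/forallP => -[].
rewrite /cube_measure ge0_integral_power_prob//.
have -> : [forall j, m j == 0]
    = (m ord0 == 0) && [forall j, m (lift ord0 j) == 0].
  apply/forallP/andP => [m0|[m0 /forallP mS] j]; first by split => //; exact/forallP.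
  by case: (unliftP ord0 j) => [k|] ->.
transitivity (\int[uniform01]_x (1 + (if [forall j, m (lift ord0 j) == 0]
    then cos (2 * pi * ((m ord0)%:~R * x)%R + c) else 0))%:E)%E.
  apply: eq_integral => x _; rewrite -(IHd (fun j => m (lift ord0 j))).
  apply: eq_integral => y _; congr (1 + cos _)%:E.
  rewrite big_ord_recl mulrDr -addrA addrCA; congr (_ * _ + _).
  by apply: eq_bigr => j _; rewrite tnthS.
case: [forall j, m (lift ord0 j) == 0].
  by rewrite integral_uniform01_cosD1 andbT.
by rewrite andbF integral_cst// [X in (_ * X)%E]probability_setT mule1.
Qed.

Lemma integrable_cube_cos d (m : 'I_d -> int) (c : R) :
  (cube_measure d).-integrable setT (fun x =>
    (cos (2 * pi * (\sum_(j < d) (m j)%:~R * tnth x j) + c))%:E).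
Proof.
apply: measurable_bounded_integrable => //.
- by rewrite [X in (X < _)%E]probability_setT ltry.
- exact: measurable_cos_tuple.
- exists 1; split => // M M1 x _; rewrite /= (le_trans _ (ltW M1))//.
  by rewrite ler_norml cos_geN1 cos_le1.
Qed.

(** The added constant 1 has integral 1 over the cube and cancels from [integral_cube_cosD1]. *)
Lemma Rintegral_cube_cos d (m : 'I_d -> int) (c : R) :
  \int[cube_measure d]_x cos (2 * pi * (\sum_(j < d) (m j)%:~R * tnth x j) + c)
  = if [forall j, m j == 0] then cos c else 0.
Proof.
have := congr1 fine (integral_cube_cosD1 m c).
rewrite -[fine _]/(Rintegral _ _ _) RintegralD//; last 2 first.
- by apply: finite_measure_integrable_cst.
- exact: integrable_cube_cos.
rewrite Rintegral_cst// [X in fine X]probability_setT mulr1 /= => /addrI.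
by [].
Qed.

End fourier.

(** * Orthogonality relations and the sparse test functions *)

Section sparse_fourier.
Context {R : realType} {d : nat}.
Implicit Types (k : 'rV[int]_d) (J : {set 'I_d}) (x : d.-tuple R).

(** This gives the three kinds of basis functions one shape, the sine being a cosine of phase
    [- (pi / 2)], so that measurability, bounds and coefficients need one treatment. *)
Lemma fourier_cosE k : exists a c : R, a ^+ 2 <= 2 /\
  forall x, fourier k x = a * cos (2 * pi * dotk k x + c).
Proof.
rewrite /fourier; case: eqP => [->|_]; last case: (Zpos k).
- exists 1, 0; split=> [|x]; first by rewrite expr1n ler1n.
  rewrite /dotk big1 ?mulr0 ?addr0 ?cos0 ?mulr1// => j _.
  by rewrite mxE mul0r.
- by exists (Num.sqrt 2), 0; split=> [|x]; rewrite ?sqr_sqrtr ?addr0.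
- exists (Num.sqrt 2), (- (pi / 2)); split=> [|x]; first by rewrite sqr_sqrtr.
  by rewrite cosBpihalf.
Qed.

Lemma measurable_fourier k : measurable_fun setT (fourier k : d.-tuple R -> R).
Proof.
have [a [c [_ fE]]] := fourier_cosE k; rewrite (funext fE).
by apply: measurable_funM => //; exact: measurable_cos_tuple.
Qed.

Lemma fourier_sqr_le2 k x : fourier k x ^+ 2 <= 2.
Proof.
have [a [c [a2 ->]]] := fourier_cosE k; rewrite exprMn (le_trans _ a2)//.
by rewrite ler_piMr ?sqr_ge0// -sqr_normr exprn_ile1// ler_norml cos_geN1 cos_le1.
Qed.

Lemma integrable_fourier_sqr k :
  (cube_measure d).-integrable setT (fun x => (fourier k x ^+ 2 : R)%:E).
Proof.
apply: measurable_bounded_integrable => //.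
- by rewrite [X in (X < _)%E]probability_setT ltry.
- by apply: measurable_funX; exact: measurable_fourier.
- exists 2; split => // M M2 x _; rewrite /= (le_trans _ (ltW M2))//.
  by rewrite ger0_norm ?sqr_ge0// fourier_sqr_le2.
Qed.

Lemma dotkD k k' x : dotk (k + k') x = dotk k x + dotk k' x.
Proof.
by rewrite -big_split; apply: eq_bigr => j _; rewrite mxE intrD mulrDl.
Qed.

Lemma dotkN k x : dotk (- k) x = - dotk k x.
Proof. by rewrite -sumrN; apply: eq_bigr => j _; rewrite mxE mulrNz mulNr. Qed.

Lemma Rintegral_cos_dotk k (c : R) :
  \int[cube_measure d]_x cos (2 * pi * dotk k x + c)
  = if k == 0 then cos c else 0.
Proof.
rewrite Rintegral_cube_cos; congr (if _ then _ else _).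
apply/forallP/eqP => [k0|-> j]; last by rewrite mxE.
by apply/rowP => j; rewrite mxE; exact/eqP.
Qed.

(** The product is half the sum of cosines of frequencies [k' + k] and [k' - k], each of mean zero
    unless its frequency vanishes. *)
Lemma Rintegral_cos_cos k k' (c : R) :
  \int[cube_measure d]_x (cos (2 * pi * dotk k x) * cos (2 * pi * dotk k' x + c))
  = ((k' == - k)%:R + (k' == k)%:R) * cos c / 2.
Proof.
have int_cos k1 c1 : (cube_measure d).-integrable setT
    (fun x => (cos (2 * pi * dotk k1 x + c1))%:E) by exact: integrable_cube_cos.
pose g k1 x : R := cos (2 * pi * dotk k1 x + c).
transitivity (\int[cube_measure d]_x ((g (k' + k) x + g (k' - k) x) * 2^-1)).
  apply: eq_Rintegral => x _; rewrite /g !dotkD dotkN.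
  set u := 2 * pi * dotk k x; set v := 2 * pi * dotk k' x + c.
  have -> : 2 * pi * (dotk k' x + dotk k x) + c = v + u by rewrite /u /v; ring.
  have -> : 2 * pi * (dotk k' x - dotk k x) + c = v - u by rewrite /u /v; ring.
  rewrite (cosD v u) (cosB v u). by field.
rewrite RintegralZr//; last first.
  exact: (integrableD measurableT (int_cos (k' + k) c) (int_cos (k' - k) c)).
rewrite RintegralD//; [|exact: int_cos|exact: int_cos].
rewrite !Rintegral_cos_dotk addr_eq0 subr_eq0.
by do 2 (case: eqP => _) => /=; ring.
Qed.

(** Orthonormality against a cosine of the basis. The second hypothesis separates [- k0] from the
    positive frequencies, in particular from [k0] itself. *)
Lemma theta_fourier k0 k : Zpos k0 -> ~~ Zpos (- k0) ->
  theta (fourier k0 : d.-tuple R -> R) k = (k == k0)%:R.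
Proof.
move=> k0_pos Nk0_npos.
have k0_neq0 : k0 != 0.
  by apply: contraL k0_pos => /eqP ->; apply/existsPn => j; rewrite mxE ltxx.
have thetaE a c : (forall x, fourier k x = a * cos (2 * pi * dotk k x + c)) ->
    theta (fourier k0 : d.-tuple R -> R) k
    = Num.sqrt 2 * a * (((k == - k0)%:R + (k == k0)%:R) * cos c / 2).
  move=> fE; rewrite -Rintegral_cos_cos -RintegralZl//.
    apply: eq_Rintegral => x _.
    by rewrite fE {1}/fourier (negbTE k0_neq0) k0_pos mulrACA.
  apply: measurable_bounded_integrable => //.
  - by rewrite [X in (X < _)%E]probability_setT ltry.
  - apply: measurable_funM; last exact: measurable_cos_tuple.
    have := @measurable_cos_tuple R d (fun j => k0 0 j) 0.
    by apply: eq_measurable_fun => x _; rewrite addr0.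
  - exists 1; split => // M M1 x _; rewrite /= (le_trans _ (ltW M1))//.
    by rewrite normrM mulr_ile1// ler_norml cos_geN1 cos_le1.
have [kE|k_neq0] := eqVneq k k0.
  rewrite (thetaE (Num.sqrt 2) 0) => [|x].
    rewrite kE eqxx cos0 mulr1 -expr2 sqr_sqrtr// mulrCA divff// mulr1.
    by case: eqP => [k0N|_]; [rewrite -k0N k0_pos in Nk0_npos|rewrite add0r].
  by rewrite kE /fourier (negbTE k0_neq0) k0_pos addr0.
case: (boolP (Zpos k)) => [k_pos|k_npos].
  have kN : (k == - k0) = false.
    by apply/eqP => kN; rewrite -kN k_pos in Nk0_npos.
  have [a [c [_ /thetaE ->]]] := fourier_cosE k.
  by rewrite kN (negbTE k_neq0) addr0 !mul0r mulr0.
have [kE|k_neq00] := eqVneq k 0.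
  have [a [c [_ /thetaE ->]]] := fourier_cosE k.
  rewrite (negbTE k_neq0) kE -addr_eq0 add0r.
  by rewrite (negbTE k0_neq0) addr0 !mul0r mulr0.
(* In the sine case [k] may equal [- k0], but the factor [cos (- (pi / 2))] is zero. *)
rewrite (thetaE (Num.sqrt 2) (- (pi / 2))) => [|x].
  by rewrite cosN cos_pihalf mulr0 mul0r mulr0.
by rewrite cosBpihalf /fourier (negbTE k_neq00) (negbTE k_npos).
Qed.

Definition indic_row J : 'rV[int]_d := \row_j (j \in J)%:Z.

(** The least element of [J] is the first nonzero position, and the entry there is 1. *)
Lemma Zpos_indic_row J : (0 < #|J|)%N -> Zpos (indic_row J).
Proof.
case/card_gt0P => i0 i0J.
case: (@arg_minnP _ i0 (mem J) val i0J) => j jJ j_min.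
apply/existsP; exists j; rewrite mxE (_ : j \in J)//=.
apply/forallP => i; apply/implyP => ij; rewrite mxE.
by case: (boolP (i \in J)) => // /j_min; rewrite leqNgt ij.
Qed.

Lemma Zpos_opp_indic_row J : ~~ Zpos (- indic_row J).
Proof. by apply/existsPn => j; rewrite !mxE; case: (j \in J). Qed.

(** A single coefficient is nonzero, so the sum collapses. Weight 1 yields [Q], and weight k_j^2 the
    smoothness sums. *)
Lemma esum_theta_fourier (D : set 'rV[int]_d) (w : 'rV[int]_d -> R) J :
  (0 < #|J|)%N -> (forall k, 0 <= w k) ->
  (\esum_(k in D) (w k * theta (fourier (indic_row J) : d.-tuple R -> R) k ^+ 2)%:E
   = (if indic_row J \in D then w (indic_row J) else 0)%:E)%E.
Proof.
move=> J_gt0 w_ge0; set k0 := indic_row J.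
have thetaE k : theta (fourier k0 : d.-tuple R -> R) k = (k == k0)%:R.
  by apply: theta_fourier; [exact: Zpos_indic_row|exact: Zpos_opp_indic_row].
rewrite esum_mkcond.
rewrite (eq_esum (b := fun k => if k \in [set k0] then
    (if k0 \in D then w k0 else 0)%:E else 0%E)); last first.
  move=> k _; rewrite thetaE.
  have -> : (k \in [set k0]) = (k == k0) by apply/idP/eqP; rewrite inE.
  case: eqP => [->|_].
    by case: ifP; rewrite // expr1n mulr1.
  by rewrite expr0n mulr0 if_same.
rewrite -esum_mkcond esum_set1//.
by rewrite lee_fin; case: ifP.
Qed.

Lemma Q_fourier_indic J j : (0 < #|J|)%N ->
  Q (fourier (indic_row J) : d.-tuple R -> R) j = (j \in J)%:R%:E.
Proof.
move=> J_gt0; rewrite /Q.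
under eq_esum do rewrite -[X in X%:E]mul1r.
rewrite (@esum_theta_fourier _ (fun=> 1))//.
case: (boolP (j \in J)) => jJ.
  by rewrite ifT// inE /= mxE jJ.
by rewrite ifF//; apply/negbTE; rewrite notin_setE /= mxE (negbTE jJ).
Qed.

Lemma sparsity_pattern_fourier J : (0 < #|J|)%N ->
  sparsity_pattern (fourier (indic_row J) : d.-tuple R -> R) = J.
Proof.
move=> J_gt0; apply/setP => j; rewrite inE Q_fourier_indic//.
by case: (j \in J); rewrite ?eqxx// eqe oner_eq0.
Qed.

Lemma fourier_Sigma J (dstar : nat) (L : R) : (0 < #|J|)%N -> (#|J| <= dstar)%N ->
  1 <= L -> Sigma dstar L (fourier (indic_row J)).
Proof.
move=> J_gt0 Jd L1; split.
- exact: measurable_fourier.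
- exact: integrable_fourier_sqr.
- move=> j; rewrite (@esum_theta_fourier _ (fun k => (k 0 j)%:~R ^+ 2))//; last first.
    by move=> k; exact: sqr_ge0.
  rewrite lee_fin mem_set// mxE (le_trans _ L1)//.
  by case: (j \in J); rewrite ?expr0n ?expr1n.
exists J; split => //; last by move=> j jJ; rewrite Q_fourier_indic// jJ.
(* The entries of [indic_row J] are 0 or 1, so [dotk] is the plain sum of the coordinates kept by
   [subvec J]. *)
exists (fun t => Num.sqrt 2 * cos (2 * pi * \sum_(i < #|J|) tnth t i)) => x.
have k_pos := Zpos_indic_row J_gt0.
have k_neq0 : indic_row J != 0.
  by apply: contraL k_pos => /eqP ->; apply/existsPn => j; rewrite mxE ltxx.
rewrite /fourier (negbTE k_neq0) k_pos; congr (_ * cos (_ * _)).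
rewrite /dotk; under [RHS]eq_bigr do rewrite tnth_mktuple.
rewrite -(big_enum_val (tnth x)) [RHS]big_mkcond/=; apply: eq_bigr => j _.
by rewrite mxE; case: (j \in J); rewrite ?mul1r ?mul0r.
Qed.

End sparse_fourier.

Theorem proposition2 (R : realType) (L alpha : R) (hL : 1 <= L)
    (halpha0 : 0 < alpha) (halpha : alpha < (ln 3 - ln 2) / ln 3) :
  exists2 c : R, 0 < c &
    forall (n d dstar : nat) (mu : probability (n.-tuple (d.-tuple R)) R),
      design_in_cube mu ->
      alpha^-1 <= dstar%:R * (ln d%:R - ln dstar%:R) / n%:R ->
      (c%:E <= minimax_risk mu dstar L)%E.
Proof.
(* Positive because [alpha] is below one half, which makes the exponent negative. *)
exists (1 - expR (1 - (2 * alpha)^-1)).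
  rewrite subr_gt0 -[ltRHS]expR0 ltr_expR subr_lt0 invf_gt1 ?mulr_gt0//.
  by rewrite mulrC -ltr_pdivlMr// mul1r; exact: alpha_lt_half.
move=> n d k mu _ alphaM.
(* Strict positivity excludes the degenerate cases: the quotient is 0 if [n] or [k] is 0 (division
   by zero gives 0), and at most 0 if [d < k]. *)
have ratio_gt0 : 0 < k%:R * (ln d%:R - ln k%:R) / n%:R :> R.
  by apply: lt_le_trans alphaM; rewrite invr_gt0.
have n_gt0 : (0 < n)%N.
  by case: n {mu alphaM} ratio_gt0 => //; rewrite invr0 mulr0 ltxx.
have k_gt0 : (0 < k)%N.
  by case: k {alphaM} ratio_gt0 => //; rewrite !mul0r ltxx.
have kd : (k <= d)%N.
  rewrite leqNgt; apply/negP => dk; move: ratio_gt0; apply/negP; rewrite -leNgt.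
  rewrite pmulr_lle0 ?invr_gt0 ?ltr0n// pmulr_rle0 ?ltr0n// subr_le0.
  (* For [d = 0] the convention that [ln 0] is 0 leaves [0 <= ln k%:R]. *)
  have [->|d_gt0] := posnP d; first by rewrite ln0// ln_ge0// ler1n.
  by rewrite ler_ln ?posrE ?ltr0n// ler_nat ltnW.
pose S := [set J : {set 'I_d} | #|J| == k]%SET.
have cardS : #|S| = 'C(d, k) by rewrite card_draws card_ord.
have S_card J : J \in S -> #|J| = k by rewrite inE => /eqP.
apply: (@le_trans _ _ (1 - expR n%:R / Num.sqrt #|S|%:R)%:E).
  rewrite lee_fin lerD2l lerN2 cardS.
  by apply: expR_div_sqrt_le => //; rewrite k_gt0.
apply: (@minimax_risk_ge R n d mu S (fun J => fourier (indic_row J))) => //.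
- by rewrite cardS bin_gt0.
- by move=> J; exact: measurable_fourier.
- by move=> J x; exact: fourier_sqr_le2.
- by move=> J /S_card Jk; apply: fourier_Sigma; rewrite ?Jk.
- by move=> J /S_card Jk; apply: sparsity_pattern_fourier; rewrite Jk.
Qed.
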